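(* Let $k\geq 0$ be an integer and let $N\in\mathbb{N}$ be odd with $N>64$. Put $$f_{k,N}(x):=\frac{4}{N^2}x^{2(2k+1)}+\frac{1}{N^2}x^{2k+1}+\frac{4}{N^2}\in\mathbb{Q}[x].$$ Then the procedure ''Reduction to a sum of 4 squares'' described in the context, run on the input $f_{k,N}(x)$, does not stop after any finite number of steps (for any admissible choice of $\varepsilon$ in step (3)).
   Context: A polynomial in $\mathbb{Q}[x]$ is a sum of 4 squares if it equals $f_1^2+f_2^2+f_3^2+f_4^2$ with $f_i\in\mathbb{Q}[x]$ (zero allowed). $\mathbb{Q}_2$ is the field of 2-adic numbers, and $\log$ is the logarithm in base 2. Procedure ''Reduction to a sum of 4 squares''. Input: a square-free polynomial $f(x)=c_0+c_1x+\dots+c_dx^d\in\mathbb{Q}[x]$ with $c_d\neq 0$ and $f(t)>0$ for all $t\in\mathbb{R}$. Intended output: $h(x)\in\mathbb{Q}[x]$ such that $f(x)-h(x)^2$ is a sum of 4 or fewer squares in $\mathbb{Q}[x]$. (1) If $f(x)$ is a sum of 4 squares in $\mathbb{Q}[x]$, return $h(x):=0$. (2) Set $f_*(x)=c_d+c_{d-1}x+\dots+c_0x^d$. (3) Find a positive number $\varepsilon$ such that $\varepsilon<\inf\{f(x):x\in\mathbb{R}\}$ and $\varepsilon<\inf\{f_*(x):x\in\mathbb{R}\}$. (4) Initialize $l:=\lceil-\frac12\log\varepsilon\rceil$. (5) Repeat forever: (a) if $f(x)-2^{-2l}$ is irreducible in $\mathbb{Q}_2[x]$, return $h(x):=2^{-l}$;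 (b) if $f(x)-2^{-2l}x^d$ is irreducible in $\mathbb{Q}_2[x]$, return $h(x):=2^{-l}x^{d/2}$; (c) set $l:=l+1$. *)

(* Defs.v *)
From HB Require Import structures.
From mathcomp Require Import all_boot all_order all_algebra.
From mathcomp Require Import all_classical all_reals all_analysis.
From mathcomp Require Import ring lra.
Set Implicit Arguments.
Unset Strict Implicit.
Unset Printing Implicit Defensive.
Import Order.TTheory GRing.Theory Num.Theory.
Local Open Scope ring_scope.

(* The ring Z_2 of 2-adic integers as the inverse limit of the Z/2^n: an       *)
(* element is a sequence whose n-th term is the canonical representative, in   *)
(* [0, 2^n), of its residue class modulo 2^n.  The single coherence condition  *)
(* also forces each term to be reduced.                                        *)
Record Z2 := MkZ2 {
  Z2_res :> nat -> int;
  Z2_coherent : forall n, Z2_res n = (Z2_res n.+1 %% 2 ^+ n)%Z }.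

HB.instance Definition _ := gen_eqMixin Z2.
HB.instance Definition _ := gen_choiceMixin Z2.

Lemma Z2_ext (x y : Z2) : (forall n, x n = y n) -> x = y.
Proof.
case: x y => [x cx] [y cy] /= /funext exy.
by subst y; congr MkZ2; exact: Prop_irrelevance.
Qed.

Lemma modz_exp2 (m : int) d n :
  ((m %% 2 ^+ (d + n))%Z = m %[mod 2 ^+ n])%Z.
Proof.
by rewrite {2}(divz_eq m (2 ^+ (d + n))) exprD mulrA modzMDl.
Qed.

Lemma Z2_mod (x : Z2) n : (x n %% 2 ^+ n)%Z = x n.
Proof. by rewrite Z2_coherent modz_mod. Qed.

Lemma Z2_of_subproof (u : nat -> int) :
    (forall n, u n.+1 = u n %[mod 2 ^+ n])%Z ->
  forall n, (u n %% 2 ^+ n)%Z = ((u n.+1 %% 2 ^+ n.+1)%Z %% 2 ^+ n)%Z.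
Proof. by move=> cu n; rewrite (modz_exp2 _ 1) cu. Qed.

Definition Z2_of (u : nat -> int)
    (cu : (forall n, u n.+1 = u n %[mod 2 ^+ n])%Z) : Z2 :=
  MkZ2 (Z2_of_subproof cu).

Lemma Z2_step (x : Z2) n : (x n.+1 = x n %[mod 2 ^+ n])%Z.
Proof. by rewrite -Z2_coherent Z2_mod. Qed.

Lemma Z2_const_subproof (m : int) n : (m = m %[mod 2 ^+ n])%Z.
Proof. by []. Qed.

Lemma Z2_opp_subproof (x : Z2) n : (- x n.+1 = - x n %[mod 2 ^+ n])%Z.
Proof. by rewrite -modzNm Z2_step modzNm. Qed.

Lemma Z2_add_subproof (x y : Z2) n :
  (x n.+1 + y n.+1 = x n + y n %[mod 2 ^+ n])%Z.
Proof. by rewrite -modzDm !Z2_step modzDm. Qed.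

Lemma Z2_mul_subproof (x y : Z2) n :
  (x n.+1 * y n.+1 = x n * y n %[mod 2 ^+ n])%Z.
Proof. by rewrite -modzMm !Z2_step modzMm. Qed.

Definition Z2_zero := Z2_of (Z2_const_subproof 0).
Definition Z2_one := Z2_of (Z2_const_subproof 1).
Definition Z2_opp x := Z2_of (Z2_opp_subproof x).
Definition Z2_add x y := Z2_of (Z2_add_subproof x y).
Definition Z2_mul x y := Z2_of (Z2_mul_subproof x y).

Fact Z2_addA : associative Z2_add.
Proof. by move=> x y z; apply: Z2_ext => n /=; rewrite modzDmr modzDml addrA. Qed.

Fact Z2_addC : commutative Z2_add.
Proof. by move=> x y; apply: Z2_ext => n /=; rewrite addrC. Qed.

Fact Z2_add0 : left_id Z2_zero Z2_add.
Proof. by move=> x; apply: Z2_ext => n /=; rewrite modzDml add0r Z2_mod. Qed.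

Fact Z2_addN : left_inverse Z2_zero Z2_opp Z2_add.
Proof. by move=> x; apply: Z2_ext => n /=; rewrite modzDml addNr. Qed.

Fact Z2_mulA : associative Z2_mul.
Proof. by move=> x y z; apply: Z2_ext => n /=; rewrite modzMmr modzMml mulrA. Qed.

Fact Z2_mulC : commutative Z2_mul.
Proof. by move=> x y; apply: Z2_ext => n /=; rewrite mulrC. Qed.

Fact Z2_mul1 : left_id Z2_one Z2_mul.
Proof. by move=> x; apply: Z2_ext => n /=; rewrite modzMml mul1r Z2_mod. Qed.

Fact Z2_mulD : left_distributive Z2_mul Z2_add.
Proof.
by move=> x y z; apply: Z2_ext => n /=; rewrite modzMml modzDm mulrDl.
Qed.

HB.instance Definition _ :=
  GRing.isZmodule.Build Z2 Z2_addA Z2_addC Z2_add0 Z2_addN.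

Fact Z2_one_neq0 : Z2_one != 0.
Proof. by apply/eqP => /(congr1 (fun x : Z2 => x 1%N)). Qed.

HB.instance Definition _ := GRing.Zmodule_isComNzRing.Build Z2
  Z2_mulA Z2_mulC Z2_mul1 Z2_mulD Z2_one_neq0.

Definition Z2_unit : {pred Z2} := fun x => `[< exists y : Z2, y * x = 1 >].

Definition Z2_inv (x : Z2) : Z2 :=
  if pselect (exists y : Z2, y * x = 1) is left e then projT1 (cid e) else x.

Fact Z2_mulV : {in Z2_unit, left_inverse 1 Z2_inv *%R}.
Proof.
move=> x /asboolP ux; rewrite /Z2_inv; case: pselect => [e|//].
exact: (projT2 (cid e)).
Qed.

Fact Z2_unitP (x y : Z2) : y * x = 1 -> Z2_unit x.
Proof. by move=> yx1; apply/asboolP; exists y. Qed.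

Fact Z2_inv_out : {in [predC Z2_unit], Z2_inv =1 id}.
Proof.
move=> x /asboolPn nux; rewrite /Z2_inv.
by case: pselect => [e|//]; case: nux.
Qed.

HB.instance Definition _ :=
  GRing.ComNzRing_hasMulInverse.Build Z2 Z2_mulV Z2_unitP Z2_inv_out.

Lemma Z2_resD (x y : Z2) n : (x + y) n = ((x n + y n) %% 2 ^+ n)%Z.
Proof. by []. Qed.

Lemma Z2_resN (x : Z2) n : (- x) n = (- x n %% 2 ^+ n)%Z.
Proof. by []. Qed.

Lemma Z2_resM (x y : Z2) n : (x * y) n = ((x n * y n) %% 2 ^+ n)%Z.
Proof. by []. Qed.

Lemma Z2_res_le (x : Z2) m n : (m <= n)%N -> x m = (x n %% 2 ^+ m)%Z.
Proof.
move=> /subnK <-; elim: (n - m)%N => [|d IH]; first by rewrite add0n Z2_mod.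
by rewrite addSn IH Z2_coherent modz_exp2.
Qed.

Fact Z2_integral (x y : Z2) : x * y = 0 -> (x == 0) || (y == 0).
Proof.
have nz (z : Z2) : z != 0 -> exists m, z m != 0.
  move=> z0; apply/not_existsP => h; move/eqP: z0; apply.
  apply: Z2_ext => n /=; rewrite mod0z.
  by apply/eqP; move: (h n) => /negP; rewrite negbK.
move=> xy0; rewrite -[_ || _]negbK negb_or; apply/negP => /andP[/nz[m xm] /nz[k yk]].
have ndvd (z : Z2) j n : (j <= n)%N -> z j != 0 -> ~~ (2 ^ j %| `|z n|)%N.
  move=> jn zj; apply: contra zj => d; apply/eqP.
  rewrite (Z2_res_le z jn); apply/dvdz_mod0P.
  by rewrite dvdzE abszX.
have := congr1 (fun z : Z2 => z (m + k)%N) xy0.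
rewrite Z2_resM [RHS]/= mod0z => /dvdz_mod0P.
rewrite dvdzE abszX abszM.
have := ndvd x m _ (leq_addr k m) xm; have := ndvd y k _ (leq_addl m k) yk.
set a := `|x _|%N; set b := `|y _|%N => nb na.
have a0 : (0 < a)%N by rewrite lt0n; apply: contraNneq na => ->; rewrite dvdn0.
have b0 : (0 < b)%N by rewrite lt0n; apply: contraNneq nb => ->; rewrite dvdn0.
move: na nb; rewrite !pfactor_dvdn ?muln_gt0 ?a0 // lognM // -!ltnNge => ha hb.
by rewrite leqNgt -addnS leq_add // ltnW.
Qed.

HB.instance Definition _ := GRing.ComUnitRing_isIntegral.Build Z2 Z2_integral.

Definition Q2 : fieldType := {fraction Z2}.

Lemma Q2_natr_neq0 n : (n.+1%:R : Q2) != 0.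
Proof.
have resn m j : (m%:R : Z2) j = (m%:Z %% 2 ^+ j)%Z.
  elim: m => [|m IH]; first by rewrite mulr0n.
  by rewrite mulrSr Z2_resD IH /= modzDm intS addrC.
rewrite -[_%:R](rmorph_nat (@FracField.tofrac Z2)) tofrac_eq0.
apply/eqP => /(congr1 (fun z : Z2 => z n.+1)); rewrite resn [RHS]/= mod0z.
move=> /dvdz_mod0P; rewrite dvdzE abszX => /dvdn_leq -/(_ isT).
by rewrite leqNgt ltn_expl.
Qed.

(* As Q2 has characteristic 0 (Q2_natr_neq0), ratr is the embedding of rat.    *)
Definition rat_to_Q2 : {poly rat} -> {poly Q2} := map_poly ratr.

Definition irreducible_over_Q2 (p : {poly rat}) : Prop :=
  irreducible_poly (rat_to_Q2 p).

Definition square_free (p : {poly rat}) : Prop :=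
  forall q : {poly rat}, size q != 1 -> ~~ (q ^+ 2 %| p).

Definition sum_of_4_squares (p : {poly rat}) : Prop :=
  exists f1 f2 f3 f4 : {poly rat},
    p = f1 ^+ 2 + f2 ^+ 2 + f3 ^+ 2 + f4 ^+ 2.

Definition real_eval (R : realType) (p : {poly rat}) (t : R) : R :=
  (map_poly ratr p).[t].

(* The number d such that p = c_0 + ... + c_d x^d with c_d != 0, for p != 0.   *)
Definition degree (p : {poly rat}) : nat := (size p).-1.

Definition reversed (p : {poly rat}) : {poly rat} :=
  \poly_(i < (degree p).+1) p`_(degree p - i).

Definition log2 (R : realType) (x : R) : R := ln x / ln 2.

Record reduction_input (R : realType) := ReductionInput {
  input_poly :> {poly rat};
  input_square_free : square_free input_poly;
  input_positive : forall t : R, 0 < real_eval input_poly t }.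

Definition admissible_eps (R : realType) (f : reduction_input R) (eps : R) :
    Prop :=
  [/\ 0 < eps,
      eps < inf (range (@real_eval R f)) &
      eps < inf (range (@real_eval R (reversed f)))].

(* A run of the reduction is a sequence of states: Looping l is the state at   *)
(* the head of the loop with current exponent l, and Returned h, which is      *)
(* stationary, means that the procedure has stopped with output h.             *)
Variant reduction_state :=
  | Looping of int
  | Returned of {poly rat}.

Definition reduction_start (R : realType) (f : {poly rat}) (eps : R) :
    reduction_state :=
  if `[< sum_of_4_squares f >] then Returned 0
  else Looping (Num.ceil (- (1 / 2) * log2 eps)).

Definition reduction_step (f : {poly rat}) (s : reduction_state) :
    reduction_state :=
  match s with
  | Returned h => Returned h
  | Looping l =>
      if `[< irreducible_over_Q2 (f - (2 ^ (- (2 * l)))%:P) >]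
      then Returned (2 ^ (- l))%:P
      else if `[< irreducible_over_Q2
                    (f - (2 ^ (- (2 * l)))%:P * 'X^(degree f)) >]
      then Returned ((2 ^ (- l))%:P * 'X^((degree f)./2))
      else Looping (l + 1)
  end.

Definition reduction_run (R : realType) (f : reduction_input R) (eps : R)
    (n : nat) : reduction_state :=
  iter n (reduction_step f) (reduction_start f eps).

Definition f_poly (k N : nat) : {poly rat} :=
  (4 / N%:R ^+ 2)%:P * 'X^(2 * (2 * k + 1))
  + (1 / N%:R ^+ 2)%:P * 'X^(2 * k + 1)
  + (4 / N%:R ^+ 2)%:P.

Lemma f_poly_positive (R : realType) k N (oddN : odd N) (t : R) :
  0 < real_eval (f_poly k N) t.
Proof.
have N0 : (0 < N%:R :> R) by rewrite ltr0n odd_gt0.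
rewrite /real_eval /f_poly !rmorphD !rmorphM /= !map_polyC /= !map_polyXn.
rewrite !(hornerD, hornerM, hornerC, hornerXn) !fmorphV /= !rmorphXn /= !rmorph_nat rmorph1.
rewrite mulnC exprM; set y := t ^+ _; set c := N%:R ^+ 2.
have c0 : 0 < c by rewrite exprn_gt0.
have -> : 4 / c * y ^+ 2 + 1 / c * y + 4 / c = (4 * y ^+ 2 + y + 4) / c.
  by field; rewrite gt_eqF.
by rewrite divr_gt0 //; nra.
Qed.

Lemma f_poly_square_free k N (oddN : odd N) : square_free (f_poly k N).
Proof.
move=> q; apply: contra => /dvdpP[r fr].
have N0 : (N%:R != 0 :> rat) by rewrite pnatr_eq0 -lt0n odd_gt0.
pose c : {poly rat} := (N%:R ^+ 2)%:P.
pose y : {poly rat} := 'X^(2 * k + 1).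
have fE : c * f_poly k N = 4 * y ^+ 2 + y + 4.
  rewrite /f_poly mulnC exprM -/y !mulrDr !mulrA /c -!polyCM.
  have e (a : rat) : N%:R ^+ 2 * (a / N%:R ^+ 2) = a.
    by rewrite mulrC divfK // expf_eq0.
  by rewrite !e polyC1 mul1r -!polyC_natr.
have q1 : q %| 4 * y ^+ 2 + y + 4.
  by rewrite -fE fr expr2 !mulrA dvdp_mull.
have q2 : q %| (8 * y + 1) * y^`().
  have d4 : (4 : {poly rat})^`() = 0 by rewrite -polyC_natr derivC.
  have dE (z : {poly rat}) : (8 * z + 1) * z^`() = (4 * z ^+ 2 + z + 4)^`().
    by rewrite derivD d4 derivD expr2 !derivM d4; ring.
  rewrite dE -fE fr.
  have -> : (c * (r * q ^+ 2))^`() =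
      q * ((c * r)^`() * q + c * r * q^`() * 2).
    by rewrite mulrA; move: (c * r) => p; rewrite expr2 !derivM; ring.
  exact: dvdp_mulr.
have q3 : q %| (8 * y + 1) * y.
  have k0 : ((2 * k + 1)%:R != 0 :> rat) by rewrite addn1 pnatr_eq0.
  move: q2; rewrite /y derivXn mulrnAr -scaler_nat dvdpZr // addn1 /=.
  by move=> /(dvdp_mulr 'X); rewrite -mulrA -exprSr.
have q4 : q %| 63 * y.
  have -> : 63 * y =
      16 * (4 * y ^+ 2 + y + 4) * y - (8 * y + 1) * ((8 * y + 1) * y).
    by ring.
  apply: dvdp_sub; last exact: dvdp_mull.
  by apply: dvdp_mulr; exact: dvdp_mull.
have q5 : q %| 252.
  have -> : 252 = 63 * (4 * y ^+ 2 + y + 4) - (4 * y + 1) * (63 * y) :> {poly rat}.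
    by ring.
  by apply: dvdp_sub; exact: dvdp_mull.
have : q %| 1.
  move: q5; rewrite -[252]polyC_natr -[_%:P]mulr1 mul_polyC dvdpZr //.
by rewrite dvdp1.
Qed.

Definition f_input (R : realType) (k N : nat) (oddN : odd N) :
    reduction_input R :=
  ReductionInput (f_poly_square_free k oddN) (f_poly_positive k oddN).

(* Main.v *)
(* Put m = 2k + 1, an odd number, and y = x^m. Up to the factor 1/N^2 the input
   is 4y^2 + y + 4, of discriminant -63 = 1 mod 8, which is a square in Q_2; so it
   factors over Q_2 into two binomials x^m - r of odd degree.  The sum of four
   squares is anisotropic over Q_2, and by Springer's argument an odd-degree
   divisor of a sum of four squares shares a factor g with all four summands, so
   that g^2 divides the input, which has no multiple factor.  Hence the loop is
   entered, and eps < f(0) = 4/N^2 < 2^-10 gives l >= 4.  From then on both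
   polynomials tested at level l are quadratics in y with discriminant
   (N^2 - 63 u^2) / (u N^2)^2, where u = 2^(l-2) is divisible by 4; the numerator
   is 1 mod 8, so both are reducible and the loop never exits. *)
Require Import Defs.
From HB Require Import structures.
From mathcomp Require Import all_boot all_order all_algebra.
From mathcomp Require Import all_classical all_reals all_analysis.
From mathcomp Require Import ring lra zify.
Set Implicit Arguments.
Unset Strict Implicit.
Unset Printing Implicit Defensive.
Import Order.TTheory GRing.Theory Num.Theory.
Local Open Scope ring_scope.

(** * Quadratics over a field *)

Lemma quadratic_factor (F : fieldType) (a b c s : F) (Y : {poly F}) :
    2 != 0 :> F -> a != 0 -> s ^+ 2 = b ^+ 2 - 4 * a * c ->
  a%:P * Y ^+ 2 + b%:P * Y + c%:P =
  a%:P * (Y - ((s - b) / (2 * a))%:P) * (Y - ((- s - b) / (2 * a))%:P).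
Proof.
move=> n2 a0 sE; set r1 := _ / _; set r2 := (- s - b) / _.
have -> : b = - (a * (r1 + r2)) by rewrite /r1 /r2; field; apply/andP.
have -> : c = a * (r1 * r2).
  apply: (mulfI (mulf_neq0 (mulf_neq0 n2 n2) a0)).
  have -> : 2 * 2 * a * (a * (r1 * r2)) = b ^+ 2 - s ^+ 2.
    by rewrite /r1 /r2; field; apply/andP.
  by rewrite sE; ring.
by rewrite !(rmorphN, rmorphM, rmorphD) /=; ring.
Qed.

(** * Sums of squares of polynomials over a field where sums of [n] squares are anisotropic *)

Section AnisotropicSquares.
Variables (F : fieldType) (n : nat).
Hypothesis aniso :
  forall a : 'I_n -> F, \sum_i a i ^+ 2 = 0 -> forall i, a i = 0.
Implicit Type G : 'I_n -> {poly F}.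

(** Leading terms cannot cancel: at the top degree, the coefficient of the sum is a sum of squares
    of coefficients, and anisotropy would force each of them to vanish. If all [G i] are zero, both
    sides are 0, since [0.-1] is 0. *)
Lemma size_sum_squares G :
  size (\sum_i G i ^+ 2) = (\max_i size (G i)).*2.-1.
Proof.
set M := \max_i _; have leM i : (size (G i) <= M)%N by exact: leq_bigmax.
case: (posnP M) => [M0|M_gt0].
  rewrite M0 big1 ?size_poly0 // => i _.
  by move: (leM i); rewrite M0 leqn0 size_poly_eq0 => /eqP ->; rewrite expr0n.
(* For [M > 0] the index is 2(M - 1). In the convolution only the diagonal term survives, as any
   other one has a factor of index at least [M]. *)
have coefM i : (G i ^+ 2)`_(M.*2.-1.-1) = (G i)`_M.-1 ^+ 2.
  rewrite expr2 coefM.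
  have h : (M.-1 < M.*2.-1.-1.+1)%N by lia.
  rewrite (bigD1 (Ordinal h)) //= big1 ?addr0 => [|j jn].
    by congr (_ * _`_ _); lia.
  have [jM|jM] := ltnP M.-1 j.
    by rewrite [(G i)`_j]nth_default ?mul0r // (leq_trans (leM i)) //; lia.
  rewrite [(G i)`_(_ - _)]nth_default ?mulr0 // (leq_trans (leM i)) //.
  have : (j : nat) != M.-1 by apply: contra jn => /eqP e; apply/eqP/val_inj.
  lia.
apply/eqP; rewrite eqn_leq; apply/andP; split.
  apply: (leq_trans (size_sum _ _ _)); apply/bigmax_leqP => i _.
  apply: (leq_trans (size_polyMleq _ _)).
  by have := leM i; lia.
rewrite leqNgt; apply/negP => lt.
have := @aniso (fun i => (G i)`_M.-1).
have : \sum_i (G i)`_M.-1 ^+ 2 = 0.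
  under eq_bigr do rewrite -coefM.
  rewrite -coef_sum nth_default // -ltnS; apply: leq_trans lt _; lia.
move=> s0 /(_ s0) G0.
have : (M <= M.-1)%N; last by lia.
apply/bigmax_leqP => i _; apply/leq_sizeP => j; rewrite leq_eqVlt => /predU1P[<-|jM].
  exact: G0.
by rewrite nth_default // (leq_trans (leM i)) //; lia.
Qed.

(* Springer's descent: once the G i are reduced modulo P and divided by their gcd
   (assumed coprime to P), anisotropy makes the degree of the sum of squares even
   and less than 2 deg P, so its cofactor H of P has odd degree less than deg P. *)
Lemma odd_degree_sum_squares (P : {poly F}) G :
    P != 0 -> ~~ odd (size P) -> P %| \sum_i G i ^+ 2 ->
  exists g : {poly F}, [/\ (1 < size g)%N, g %| P & forall i, g %| G i].
Proof.
have [m] := ubnP (size P); elim: m P G => // m IH P G leP P0 evP PG.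
have [/forallP dvG|] := boolP [forall i, P %| G i].
  exists P; split=> //.
  by move: P0 evP; rewrite -size_poly_eq0; case: (size P) => [|[]].
rewrite negb_forall => /existsP[i0 ndv].
pose R i := G i %% P.
have PR : P %| \sum_i R i ^+ 2.
  rewrite -(dvdp_addr _ (_ : P %| \sum_i (G i ^+ 2 - R i ^+ 2))).
    by rewrite -big_split /= (eq_bigr (fun i => G i ^+ 2)) // => i _; rewrite subrK.
  apply: (big_ind (fun p => P %| p)) => [|x y|i _]; [exact: dvdp0|exact: dvdp_add|].
  rewrite subr_sqr dvdp_mulr // /R {1}(divp_eq (G i) P) addrK.
  exact: dvdp_mulIr.
pose D : {poly F} := \big[@gcdp F/0]_i R i.
have dvDR i : D %| R i.
  rewrite /D; have : i \in index_enum 'I_n by rewrite mem_index_enum.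
  elim: (index_enum _) => // j r IHr; rewrite big_cons inE => /predU1P[->|ir].
    exact: dvdp_gcdl.
  by apply: dvdp_trans (dvdp_gcdr _ _) _; exact: IHr.
have dvD g : (forall i, g %| R i) -> g %| D.
  move=> gR; apply: (big_ind (fun p => g %| p)) => [|x y gx gy|i _];
    [exact: dvdp0| |exact: gR].
  by rewrite dvdp_gcd gx.
have R0 : R i0 != 0 by exact: ndv.
have D0 : D != 0 by apply: contraNneq R0 => D0; have := dvDR i0; rewrite D0 dvd0p.
have dvPG g : g %| P -> (forall i, g %| R i) -> forall i, g %| G i.
  move=> gP gR i; rewrite (divp_eq (G i) P).
  by apply: dvdp_add; [exact: dvdp_mull|exact: gR].
(* If [P] and [D] share a factor, their gcd already is the required [g]. *)
have [cop|ncop] := boolP (coprimep P D); last first.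
  exists (gcdp P D); split.
  - by rewrite ltn_neqAle eq_sym ncop size_poly_gt0 gcdp_eq0 negb_and P0.
  - exact: dvdp_gcdl.
  - apply: dvPG; first exact: dvdp_gcdl.
    by move=> i; apply: dvdp_trans (dvdp_gcdr _ _) (dvDR i).
pose S i := R i %/ D.
have RE i : R i = S i * D by rewrite divpK.
have PS : P %| \sum_i S i ^+ 2.
  rewrite -(Gauss_dvdpl _ (_ : coprimep P (D ^+ 2))) ?coprimep_expr //.
  rewrite mulr_suml (eq_bigr (fun i => R i ^+ 2)) // => i _.
  by rewrite RE exprMn.
have sS i : (size (S i) < size P)%N.
  apply: (@leq_ltn_trans (size (R i))); last by rewrite ltn_modp.
  by rewrite size_divp // leq_subr.
have S0 : S i0 != 0 by apply: contraNneq R0 => e; rewrite RE e mul0r.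
case/dvdpP: PS => H HE.
have szM : (0 < \max_i size (S i) < size P)%N.
  apply/andP; split; first by apply: leq_trans (leq_bigmax i0); rewrite size_poly_gt0.
  have P_gt0 : (0 < size P)%N by rewrite size_poly_gt0.
  by rewrite -(ltn_predK P_gt0) ltnS; apply/bigmax_leqP => i _; have := sS i; lia.
have := size_sum_squares S; move: (\max_i _)%N szM => M szM szE.
have H0 : H != 0.
  apply/eqP => e; move: szE; rewrite HE e mul0r size_poly0.
  by move: szM; clear; lia.
have szH : (size H + size P).-1 = M.*2.-1 by rewrite -size_mul // -HE.
(* Here size H = 2M - size P, which is even, and [M < size P] makes it smaller than [size P]. *)
have [|||g [g1 gH gS]] := IH H S _ H0.
- by move: szH szM leP; clear; lia.
- have H_gt0 : (0 < size H)%N by rewrite size_poly_gt0.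
  by move: szH szM evP H_gt0; clear; lia.
- by rewrite HE dvdp_mulr.
(* The coprime case is contradictory: a common factor [g] of the [S i] makes [g * D] a common
   divisor of the [R i], although [D] is their gcd. *)
have gD : g * D %| D.
  by apply: dvD => i; rewrite RE dvdp_mul2r.
exfalso; have := dvdp_leq D0 gD.
rewrite size_mul //; last by rewrite -size_poly_gt0 ltnW.
have pred_addn_gt x y : (1 < x)%N -> (0 < y)%N -> (y < (x + y).-1)%N by clear; lia.
by rewrite leqNgt pred_addn_gt // size_poly_gt0.
Qed.

End AnisotropicSquares.

(** * Products of two binomials, and trinomials in X^m *)

Section TwoBinomials.
Variables (F : fieldType) (a r1 r2 : F) (m : nat).
Hypotheses (a0 : a != 0) (m_gt0 : (0 < m)%N).

Let p : {poly F} := a%:P * ('X^m - r1%:P) * ('X^m - r2%:P).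

Lemma reducible_two_binomials : ~ irreducible_poly p.
Proof.
case=> _ /(_ ('X^m - r1%:P)).
have sz r : size ('X^m - r%:P : {poly F}) = m.+1 by exact: size_XnsubC.
have nz r : 'X^m - r%:P != 0 :> {poly F} by rewrite -size_poly_gt0 sz.
rewrite sz eqSS -lt0n m_gt0 /p mulrAC dvdp_mull // => /(_ isT isT)/eqp_size.
rewrite -mulrA mul_polyC size_scale // size_mul // !sz.
by move: m_gt0; lia.
Qed.

(** A common factor g of X^m - r1 and all the summands has g^2 dividing [p]. As the two binomials
    are coprime, g^2 divides X^m - r1, so g divides the derivative m X^(m-1), hence X^m, hence the
    nonzero constant r1. *)
Lemma two_binomials_not_sum_squares n (G : 'I_n -> {poly F}) :
    (forall b : 'I_n -> F, \sum_i b i ^+ 2 = 0 -> forall i, b i = 0) ->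
    odd m -> m%:R != 0 :> F -> r1 != 0 -> r1 != r2 ->
  p != \sum_i G i ^+ 2.
Proof.
move=> aniso oddm m0 r10 r12; apply/eqP => pE.
pose P : {poly F} := 'X^m - r1%:P; pose Q : {poly F} := 'X^m - r2%:P.
have szP : size P = m.+1 by exact: size_XnsubC.
have [||| g [g1 gP gG]] := odd_degree_sum_squares aniso (P := P) (G := G).
- by rewrite -size_poly_gt0 szP.
- by rewrite szP /= oddm.
- by rewrite -pE /p mulrAC dvdp_mull.
(* The binomials differ by the nonzero constant r1 - r2. *)
have PQ : coprimep P Q.
  have -> : Q = 1 * P + (r1 - r2)%:P by rewrite /P /Q rmorphB /=; ring.
  rewrite coprimep_addl_mul -[_%:P]mulr1 mul_polyC coprimepZr ?coprimep1 //.
  by rewrite subr_eq0.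
have g2 : g ^+ 2 %| P.
  have gQ : coprimep (g ^+ 2) Q by rewrite coprimep_expl // (coprimep_dvdr gP).
  rewrite -(Gauss_dvdpl _ gQ) -(dvdpZr _ _ a0) -mul_polyC mulrA.
  rewrite -/p pE; apply: (big_ind (fun q => g ^+ 2 %| q)) => [|x y|i _].
  - exact: dvdp0.
  - exact: dvdp_add.
  - exact: dvdp_exp2r.
have gP' : g %| P^`().
  case/dvdpP: g2 => q ->; rewrite expr2 !derivM.
  have -> : q^`() * (g * g) + q * (g^`() * g + g * g^`()) =
            g * (q^`() * g + q * g^`() * 2) by ring.
  exact: dvdp_mulIl.
have gX : g %| 'X^m.
  move: gP'; rewrite derivB derivXn derivC subr0 -scaler_nat dvdpZr //.
  by move/(dvdp_mulr 'X); rewrite -exprSr prednK.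
have : g %| r1%:P.
  have -> : r1%:P = 'X^m - P by rewrite /P; ring.
  exact: dvdp_sub.
move/dvdp_leq; rewrite polyC_eq0 r10 size_polyC r10 => /(_ isT).
by rewrite leqNgt g1.
Qed.

End TwoBinomials.

(** The input and both polynomials tested in the loop have this shape; only the outer coefficients
    vary. *)
Definition trinomial (R : nzRingType) (a b c : R) (m : nat) : {poly R} :=
  a%:P * 'X^(2 * m) + b%:P * 'X^m + c%:P.

Lemma map_trinomial (R S : nzRingType) (f : {rmorphism R -> S}) a b c m :
  map_poly f (trinomial a b c m) = trinomial (f a) (f b) (f c) m.
Proof. by rewrite /trinomial !(rmorphD, rmorphM) /= !map_polyC !map_polyXn. Qed.

Section TrinomialFactors.
Variables (F : fieldType) (a b c s : F) (m : nat).
Hypotheses (two0 : 2 != 0 :> F) (a0 : a != 0) (m_gt0 : (0 < m)%N).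
Hypothesis discE : s ^+ 2 = b ^+ 2 - 4 * a * c.

Lemma reducible_trinomial : ~ irreducible_poly (trinomial a b c m).
Proof.
rewrite /trinomial mulnC exprM (quadratic_factor _ two0 a0 discE).
exact: reducible_two_binomials.
Qed.

Lemma trinomial_not_sum_squares n (G : 'I_n -> {poly F}) :
    (forall x : 'I_n -> F, \sum_i x i ^+ 2 = 0 -> forall i, x i = 0) ->
    odd m -> m%:R != 0 :> F -> c != 0 -> s != 0 ->
  trinomial a b c m != \sum_i G i ^+ 2.
Proof.
move=> aniso oddm m0 c0 s0.
rewrite /trinomial mulnC exprM (quadratic_factor _ two0 a0 discE).
apply: two_binomials_not_sum_squares => //.
  (* The first root is nonzero: otherwise s = b, and the discriminant formula gives 4ac = 0. *)
  have ac0 : 2 * 2 * a * c != 0 by rewrite !mulf_neq0.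
  rewrite mulf_neq0 ?invr_eq0 ?mulf_neq0 //.
  apply: contraNneq ac0 => /subr0_eq sb; move: discE; rewrite sb => bE.
  have -> : 2 * 2 * a * c = b ^+ 2 - (b ^+ 2 - 4 * a * c) by ring.
  by rewrite -bE subrr.
(* Equal roots would force s = -s, hence s = 0. *)
apply: contra_neq s0 => /(mulIf _); rewrite invr_eq0 mulf_neq0 // => /(_ isT) sb.
by apply: (mulfI two0); rewrite mulr0 -(subrr (s - b)) [X in _ = _ - X]sb; ring.
Qed.

End TrinomialFactors.

(** * Square roots of integers congruent to 1 modulo 8 *)

Lemma Z2_res_int (z : int) n : (z%:~R : Z2) n = (z %% 2 ^+ n)%Z.
Proof.
have res_nat m : (m%:R : Z2) n = (m%:Z %% 2 ^+ n)%Z.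
  elim: m => [|m IH]; first by rewrite mulr0n.
  by rewrite mulrSr Z2_resD IH /= modzDm intS addrC.
case: z => m; first exact: res_nat.
by rewrite NegzE mulrNz Z2_resN -pmulrn res_nat modzNm.
Qed.

(* Odd approximate square roots: sqrt_seq z n squares to z modulo 2^(n+3). *)
Fixpoint sqrt_seq (z : int) (n : nat) : int :=
  if n is n'.+1 then
    let u := sqrt_seq z n' in
    if (2 ^+ (n' + 4) %| u ^+ 2 - z)%Z then u else u + 2 ^+ (n' + 2)
  else 1.

(** For odd u, adding 2^(n+2) changes u^2 by u 2^(n+3) + 2^(2n+4). If u^2 - z = q 2^(n+3) with q
    odd, then q + u is even, and the correction gains one binary digit. *)
Lemma sqrt_seqP (z : int) n : (8 %| z - 1)%Z ->
  ~~ (2 %| sqrt_seq z n)%Z /\ (2 ^+ (n + 3) %| sqrt_seq z n ^+ 2 - z)%Z.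
Proof.
move=> z8; elim: n => [|n [oddu IH]] /=.
  by split=> //; rewrite expr1n -opprB rpredN.
case: ifPn => [dv|ndv]; first by split=> //; rewrite addSnnS.
split.
  by rewrite rpredDr // exprD dvdz_mull.
set u := sqrt_seq z n in oddu IH ndv *.
case/dvdzP: IH => q qE.
have oddq : ~~ (2 %| q)%Z.
  apply: contra ndv => /dvdzP[r rE]; rewrite qE rE.
  by apply/dvdzP; exists r; rewrite !exprD; ring.
have [v vE] : exists v, q + u = v * 2.
  by exists ((q + u) %/ 2)%Z; lia.
apply/dvdzP; exists (v + 2 ^+ n).
have -> : (u + 2 ^+ (n + 2)) ^+ 2 - z =
          (q + u) * 2 ^+ (n + 3) + 2 ^+ n * 2 ^+ (n + 4).
  have -> : z = u ^+ 2 - q * 2 ^+ (n + 3) by rewrite -qE; ring.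
  by rewrite !exprD; ring.
by rewrite vE addSn exprS !exprD; ring.
Qed.

Lemma sqrt_seq_coherent (z : int) n :
  (sqrt_seq z n.+1 = sqrt_seq z n %[mod 2 ^+ n])%Z.
Proof.
by rewrite /=; case: ifP => // _; rewrite exprD mulrC addrC modzMDl.
Qed.

Lemma Q2_sqrt (z : int) : (8 %| z - 1)%Z -> exists s : Q2, s ^+ 2 = z%:~R.
Proof.
move=> z8; pose s := Z2_of (sqrt_seq_coherent z).
exists (@FracField.tofrac Z2 s).
rewrite -rmorphXn -(rmorph_int (@FracField.tofrac Z2)); congr (FracField.tofrac _).
apply: Z2_ext => n; rewrite Z2_res_int expr2 Z2_resM /= modzMm -expr2.
have [_ dv] := sqrt_seqP n z8.
by apply/eqP; rewrite eqz_mod_dvd; apply: dvdz_trans dv; rewrite exprD dvdz_mulr.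
Qed.

(** * Anisotropy of the sum of four squares over Q_2 *)

Lemma even_or_sqr_mod8 (a : int) :
  (exists b, a = 2 * b) \/ exists t, a ^+ 2 = 8 * t + 1.
Proof.
have [/dvdzP[b ->]|odda] := boolP (2 %| a)%Z; first by left; exists b; rewrite mulrC.
have [b ->] : exists b, a = 2 * b + 1 by exists (a %/ 2)%Z; lia.
have [t tE] : exists t, b * (b + 1) = 2 * t.
  have [/dvdzP[c ->]|oddb] := boolP (2 %| b)%Z; first by exists (c * (c * 2 + 1)); ring.
  have [c ->] : exists c, b = 2 * c + 1 by exists (b %/ 2)%Z; lia.
  by exists ((2 * c + 1) * (c + 1)); ring.
right; exists t.
have -> : (2 * b + 1) ^+ 2 = 4 * (b * (b + 1)) + 1 by ring.
by rewrite tE; ring.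
Qed.

(** Squares are 0 modulo 4 or 1 modulo 8. With [a] odd, divisibility by 4 forces all four terms to
    be odd, and then the sum is 4 modulo 8. *)
Lemma even_of_sum4_squares (a b c d : int) :
  (8 %| a ^+ 2 + b ^+ 2 + c ^+ 2 + d ^+ 2)%Z -> exists e, a = 2 * e.
Proof.
move=> /dvdzP[q]; have [//|[t ->]] := even_or_sqr_mod8 a.
have sqr (x : int) : exists t, x ^+ 2 = 4 * t \/ x ^+ 2 = 8 * t + 1.
  have [[y ->]|[y ->]] := even_or_sqr_mod8 x; last by exists y; right.
  by exists (y ^+ 2); left; ring.
have [u uE] := sqr b; have [w wE] := sqr c; have [z zE] := sqr d.
move: (b ^+ 2) (c ^+ 2) (d ^+ 2) uE wE zE => B C D.
clear; lia.
Qed.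

(** Descent: all four integers are even, and halving them divides the sum by 4. *)
Lemma sum4_squares_dvd (a b c d : int) n :
    (8 * 4 ^+ n %| a ^+ 2 + b ^+ 2 + c ^+ 2 + d ^+ 2)%Z ->
  (2 ^+ n.+1 %| a)%Z.
Proof.
elim: n a b c d => [|n IH] a b c d dv.
  have [|e ->] := @even_of_sum4_squares a b c d; first by rewrite mulr1 in dv.
  by rewrite dvdz_mulr.
have dv8 : (8 %| a ^+ 2 + b ^+ 2 + c ^+ 2 + d ^+ 2)%Z.
  by apply: dvdz_trans dv; rewrite dvdz_mulr.
have [a' aE] := even_of_sum4_squares dv8.
have [|b' bE] := @even_of_sum4_squares b a c d; first by rewrite [b ^+ 2 + _]addrC.
have [|c' cE] := @even_of_sum4_squares c b a d.
  by rewrite (_ : _ + _ = a ^+ 2 + b ^+ 2 + c ^+ 2 + d ^+ 2) //; ring.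
have [|d' dE] := @even_of_sum4_squares d b c a.
  by rewrite (_ : _ + _ = a ^+ 2 + b ^+ 2 + c ^+ 2 + d ^+ 2) //; ring.
rewrite aE exprS dvdz_mul2l //; apply: (IH a' b' c' d').
rewrite -(@dvdz_mul2l 4) //; move: dv; rewrite aE bE cE dE.
have -> : (2 * a') ^+ 2 + (2 * b') ^+ 2 + (2 * c') ^+ 2 + (2 * d') ^+ 2 =
          4 * (a' ^+ 2 + b' ^+ 2 + c' ^+ 2 + d' ^+ 2) by ring.
by rewrite [4 ^+ n.+1]exprS mulrCA.
Qed.

Lemma Z2_sum4_squares_eq0 (a b c d : Z2) :
  a ^+ 2 + b ^+ 2 + c ^+ 2 + d ^+ 2 = 0 -> a = 0.
Proof.
move=> s0; apply: Z2_ext => n; rewrite [RHS]/= mod0z.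
have [->|n0] := posnP n; first by rewrite -(Z2_mod a 0) expr0 modz1.
(* Precision 2n + 1 suffices because 2^(2n+1) = 8 * 4^(n-1), which yields 2^n dividing the residue
   of [a]. The exponent n - 1 is why n = 0 was treated apart. *)
have := congr1 (fun z : Z2 => z (2 * n + 1)%N) s0.
rewrite !expr2 !Z2_resD !Z2_resM !modzDm -addrA modzDml addrCA modzDml [RHS]/= mod0z.
rewrite addrCA addrA -!expr2 => /dvdz_mod0P dv.
rewrite (@Z2_res_le a n (2 * n + 1)); last by lia.
apply/dvdz_mod0P; rewrite -[n in 2 ^+ n](prednK n0).
apply: (@sum4_squares_dvd _ (b (2 * n + 1)%N) (c (2 * n + 1)%N) (d (2 * n + 1)%N)).
suff -> : 8 * 4 ^+ n.-1 = 2 ^+ (2 * n + 1) :> int by [].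
have -> : (2 * n + 1 = 3 + 2 * n.-1)%N by lia.
by rewrite exprD exprM.
Qed.

Lemma fractionP (R : idomainType) (x : {fraction R}) :
  exists n d, d != 0 /\ x = FracField.tofrac n / FracField.tofrac d.
Proof.
elim/quotW: x => r; exists r.1, r.2; rewrite denom_ratioP; split=> //.
apply: (canRL (mulfK _)); first by rewrite tofrac_eq0 denom_ratioP.
apply/eqP; rewrite !piE /FracField.equivf /FracField.mulf /=.
rewrite !numden_Ratio ?(oner_eq0, mulf_neq0, denom_ratioP) //.
by rewrite !mulr1 mulrC.
Qed.

Lemma fraction_sum4_squares_eq0 (R : idomainType) :
    (forall a b c d : R, a ^+ 2 + b ^+ 2 + c ^+ 2 + d ^+ 2 = 0 -> a = 0) ->
  forall a b c d : {fraction R},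
    a ^+ 2 + b ^+ 2 + c ^+ 2 + d ^+ 2 = 0 -> a = 0.
Proof.
move=> aniso a b c d.
have [na [da [da0 ->]]] := fractionP a; have [nb [db [db0 ->]]] := fractionP b.
have [nc [dc [dc0 ->]]] := fractionP c; have [nd [dd [dd0 ->]]] := fractionP d.
move=> s0; suff -> : na = 0 by rewrite rmorph0 mul0r.
have clear_denominators (F : fieldType) (xa ya xb yb xc yc xd yd : F) :
    ya != 0 -> yb != 0 -> yc != 0 -> yd != 0 ->
    (xa / ya) ^+ 2 + (xb / yb) ^+ 2 + (xc / yc) ^+ 2 + (xd / yd) ^+ 2 = 0 ->
    (xa * (yb * yc * yd)) ^+ 2 + (xb * (ya * yc * yd)) ^+ 2 +
    (xc * (ya * yb * yd)) ^+ 2 + (xd * (ya * yb * yc)) ^+ 2 = 0.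
  move=> ya0 yb0 yc0 yd0 e.
  rewrite -[RHS](mulr0 ((ya * yb * yc * yd) ^+ 2)) -e.
  by field; rewrite ya0 yb0 yc0 yd0.
have s1 : (na * (db * dc * dd)) ^+ 2 + (nb * (da * dc * dd)) ^+ 2 +
  (nc * (da * db * dd)) ^+ 2 + (nd * (da * db * dc)) ^+ 2 = 0.
  apply/eqP; rewrite -tofrac_eq0 !tofracD !tofracXn !tofracM; apply/eqP.
  by apply: clear_denominators; rewrite ?tofrac_eq0.
move/eqP: (aniso _ _ _ _ s1).
by rewrite !mulf_eq0 (negbTE db0) (negbTE dc0) (negbTE dd0) !orbF => /eqP.
Qed.

Lemma Q2_sum4_squares_eq0 (a b c d : Q2) :
  a ^+ 2 + b ^+ 2 + c ^+ 2 + d ^+ 2 = 0 -> a = 0.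
Proof. exact: (fraction_sum4_squares_eq0 Z2_sum4_squares_eq0). Qed.

Lemma Q2_sum_squares_anisotropic (b : 'I_4 -> Q2) :
  \sum_i b i ^+ 2 = 0 -> forall i, b i = 0.
Proof.
pose c j := b (inord j); have bE i : b i = c i by rewrite /c inord_val.
under eq_bigr do rewrite bE.
rewrite !big_ord_recl big_ord0 addr0 /= /bump /= => c0 i; rewrite bE.
(* The four-variable statement only kills its first variable, so each index in turn is moved to the
   front. *)
have sum4 x y z t : c x ^+ 2 + c y ^+ 2 + c z ^+ 2 + c t ^+ 2 =
    c 0%N ^+ 2 + (c 1%N ^+ 2 + (c 2%N ^+ 2 + c 3%N ^+ 2)) -> c x = 0.
  by rewrite c0; exact: Q2_sum4_squares_eq0.
case: i => [[|[|[|[|]]]] //= _].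
- by apply: (sum4 _ 1 2 3)%N; ring.
- by apply: (sum4 _ 0 2 3)%N; ring.
- by apply: (sum4 _ 0 1 3)%N; ring.
- by apply: (sum4 _ 0 1 2)%N; ring.
Qed.

(** * The embedding of Q into Q_2 as a ring morphism *)

(* The library makes ratr a ring morphism only into a numFieldType. *)
Definition rat_Q2 : rat -> Q2 := ratr.

Lemma Q2_natr_gt0 n : (0 < n)%N -> n%:R != 0 :> Q2.
Proof. by case: n => // n _; exact: Q2_natr_neq0. Qed.

Lemma Q2_intr_eq0 (z : int) : ((z%:~R : Q2) == 0) = (z == 0).
Proof.
case: z => [[|n]|n]; first by rewrite !eqxx.
  by apply/idP/idP => //; rewrite (negbTE (Q2_natr_neq0 n)).
by apply/idP/idP => //; rewrite NegzE mulrNz oppr_eq0 (negbTE (Q2_natr_neq0 n)).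
Qed.

(** [ratr] is defined by the reduced fraction; once any representative may be used, the morphism
    laws reduce to arithmetic of fractions. *)
Lemma rat_Q2_divz (x y : int) : y != 0 -> rat_Q2 (x%:~R / y%:~R) = x%:~R / y%:~R.
Proof.
move=> y0; rewrite /rat_Q2 /ratr; set q : rat := _ / _.
have dq : (denq q)%:~R != 0 :> Q2 by rewrite Q2_intr_eq0 denq_eq0.
apply/eqP; rewrite eqr_div ?Q2_intr_eq0 // -!intrM; apply/eqP; congr _%:~R.
apply: (@intr_inj rat); rewrite !rmorphM /= numqE /q.
by field; rewrite intr_eq0.
Qed.

Fact rat_Q2_zmod_morphism : zmod_morphism rat_Q2.
Proof.
move=> x y; rewrite -[x]divq_num_den -[y]divq_num_den.
move: (numq x) (denq x) (denq_neq0 x) (numq y) (denq y) (denq_neq0 y).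
move=> a b b0 c d d0; rewrite -mulNr addf_div ?intr_eq0 // mulNr.
rewrite -!rmorphM -rmorphB !rat_Q2_divz ?mulf_neq0 // rmorphB !rmorphM /=.
by rewrite -mulNr -[in RHS]mulNr addf_div ?Q2_intr_eq0.
Qed.

Fact rat_Q2_monoid_morphism : monoid_morphism rat_Q2.
Proof.
split=> [|x y]; first by rewrite /rat_Q2 /ratr divr1.
rewrite -[x]divq_num_den -[y]divq_num_den.
move: (numq x) (denq x) (denq_neq0 x) (numq y) (denq y) (denq_neq0 y).
move=> a b b0 c d d0; rewrite mulf_div -!rmorphM !rat_Q2_divz ?mulf_neq0 //.
by rewrite !rmorphM -mulf_div.
Qed.

HB.instance Definition _ := GRing.isZmodMorphism.Build rat Q2 rat_Q2
  rat_Q2_zmod_morphism.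
HB.instance Definition _ := GRing.isMonoidMorphism.Build rat Q2 rat_Q2
  rat_Q2_monoid_morphism.

Lemma Q2_sqrt_rat (z : int) (w : rat) : (8 %| z - 1)%Z ->
  exists s : Q2, s ^+ 2 = rat_Q2 (z%:~R / w ^+ 2).
Proof.
move=> /Q2_sqrt[s sE]; exists (s / rat_Q2 w).
by rewrite expr_div_n sE fmorph_div rmorphXn rmorph_int.
Qed.

(** * Rational trinomials whose discriminant is z / w^2 with z = 1 modulo 8, hence a square in
    Q_2 *)

Section RationalTrinomial.
Variables (a b c w : rat) (z : int) (m : nat).
Hypotheses (a0 : a != 0) (m_gt0 : (0 < m)%N) (z8 : (8 %| z - 1)%Z).
Hypothesis discE : b ^+ 2 - 4 * a * c = z%:~R / w ^+ 2.

Let Q2_disc : exists s : Q2,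
  s ^+ 2 = rat_Q2 b ^+ 2 - 4 * rat_Q2 a * rat_Q2 c.
Proof.
have [s sE] := Q2_sqrt_rat w z8; exists s.
by rewrite sE -discE rmorphB rmorphXn !rmorphM rmorph_nat.
Qed.

Let rat_to_Q2_trinomial : rat_to_Q2 (trinomial a b c m) =
  trinomial (rat_Q2 a) (rat_Q2 b) (rat_Q2 c) m.
Proof. exact: (map_trinomial rat_Q2). Qed.

Let ra0 : rat_Q2 a != 0.
Proof. by rewrite fmorph_eq0. Qed.

Lemma rat_trinomial_reducible : ~ irreducible_over_Q2 (trinomial a b c m).
Proof.
have [s sE] := Q2_disc; rewrite /irreducible_over_Q2 rat_to_Q2_trinomial.
exact: (reducible_trinomial (Q2_natr_neq0 1) ra0 m_gt0 sE).
Qed.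

Lemma rat_trinomial_not_sum_of_4_squares :
  odd m -> c != 0 -> w != 0 -> ~ sum_of_4_squares (trinomial a b c m).
Proof.
move=> oddm c0 w0 [f1 [f2 [f3 [f4 fE]]]]; have [s sE] := Q2_disc.
pose G (i : 'I_4) : {poly Q2} := map_poly rat_Q2 (nth 0 [:: f1; f2; f3; f4] i).
have z0 : z != 0 by apply: contraTneq z8 => ->.
have s0 : s != 0.
  have : s ^+ 2 != 0; last by rewrite expf_eq0.
  rewrite sE -(rmorph_nat rat_Q2) -rmorphXn -!rmorphM -rmorphB.
  by rewrite fmorph_eq0 discE mulf_neq0 ?intr_eq0 // invr_eq0 expf_neq0.
have /negP := trinomial_not_sum_squares (Q2_natr_neq0 1) ra0 m_gt0 sE G
  Q2_sum_squares_anisotropic oddm (Q2_natr_gt0 m_gt0)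
  (etrans (congr1 negb (fmorph_eq0 rat_Q2 c)) c0) s0.
apply; rewrite -map_trinomial fE.
rewrite !big_ord_recl big_ord0 addr0 /G /= !(rmorphD, rmorphXn) /=.
by rewrite !addrA.
Qed.

End RationalTrinomial.

(** * The input polynomial and the runs of the procedure on it *)

Section FPoly.
Variables (k N : nat).
Hypothesis oddN : odd N.

Let m := (2 * k + 1)%N.
Let A : rat := 4 / N%:R ^+ 2.
Let B : rat := 1 / N%:R ^+ 2.

Let N0 : N%:R != 0 :> rat.
Proof. by rewrite pnatr_eq0 -lt0n odd_gt0. Qed.

Let A0 : A != 0.
Proof. by rewrite mulf_neq0 // invr_eq0 expf_neq0. Qed.

Let m_gt0 : (0 < m)%N.
Proof. by rewrite /m addn1. Qed.

Lemma degree_f_poly : degree (f_poly k N) = (2 * m)%N.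
Proof.
have B0 : B != 0 by rewrite mulf_neq0 // invr_eq0 expf_neq0.
rewrite /degree /f_poly -/m -/A -/B !mul_polyC -addrA.
by rewrite !size_polyDl ?size_scale ?size_polyXn ?size_polyC ?A0 //; lia.
Qed.

Lemma f_poly_not_sum_of_4_squares : ~ sum_of_4_squares (f_poly k N).
Proof.
(* The discriminant is (1 - 64) / N^4. *)
apply: (@rat_trinomial_not_sum_of_4_squares _ _ _ (N%:R ^+ 2) (- 63)) => //.
- by rewrite /A /B; field.
- by rewrite addn1 /= mul2n odd_double.
- by rewrite expf_neq0.
Qed.

Let odd_square_diff (u : nat) :
  (4 %| u)%N -> (8 %| N%:Z ^+ 2 - 63 * u%:Z ^+ 2 - 1)%Z.
Proof.
case/dvdnP => w ->; have [[b bE]|[t ->]] := even_or_sqr_mod8 N.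
  by move: oddN; lia.
by rewrite PoszM; apply/dvdzP; exists (t - 126 * w%:Z ^+ 2); ring.
Qed.

(** The witness is u = 2^(l-2), so that 4u = 2^l; the bound l >= 4 is what makes u divisible by
    4. *)
Let inverse_power (l : nat) : (4 <= l)%N -> exists u,
  [/\ (4 %| u)%N, u%:R != 0 :> rat & 2 ^ (- (2 * l%:Z)) = 1 / (4 * u%:R) ^+ 2 :> rat].
Proof.
move=> l4; exists (2 ^ (l - 2))%N; split.
- by rewrite (@dvdn_exp2l 2 2) //; lia.
- by rewrite pnatr_eq0 expn_eq0.
rewrite -PoszM -exprnN mulnC exprM div1r; congr (_ ^- 2).
have -> : 4 = 2 ^+ 2 :> rat by rewrite -natrX.
by rewrite natrX -exprD subnKC // ltnW // ltnW.
Qed.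

Lemma step_a_reducible (l : nat) : (4 <= l)%N ->
  ~ irreducible_over_Q2 (f_poly k N - (2 ^ (- (2 * l%:Z)))%:P).
Proof.
case/inverse_power => u [u4 u0 ->].
have -> : f_poly k N - (1 / (4 * u%:R) ^+ 2)%:P =
          trinomial A B (A - 1 / (4 * u%:R) ^+ 2) m.
  by rewrite /trinomial rmorphB addrA.
apply: (@rat_trinomial_reducible _ _ _ (u%:R * N%:R ^+ 2)
          (N%:Z ^+ 2 - 63 * u%:Z ^+ 2)) => //.
  exact: odd_square_diff.
by rewrite rmorphB rmorphXn rmorphM rmorphXn /= /A /B; field; rewrite N0 u0.
Qed.

(** Compared with step (a) the outer coefficients are exchanged, which leaves the discriminant
    unchanged. What is new is that the leading coefficient must be shown nonzero. *)
Lemma step_b_reducible (l : nat) : (4 <= l)%N ->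
  ~ irreducible_over_Q2
      (f_poly k N - (2 ^ (- (2 * l%:Z)))%:P * 'X^(degree (f_poly k N))).
Proof.
case/inverse_power => u [u4 u0 ->]; rewrite degree_f_poly.
have -> : f_poly k N - (1 / (4 * u%:R) ^+ 2)%:P * 'X^(2 * m) =
          trinomial (A - 1 / (4 * u%:R) ^+ 2) B A m.
  rewrite /trinomial /f_poly -/m -/A -/B rmorphB /=.
  by move: 'X^_ 'X^_ => Y Z; ring.
apply: (@rat_trinomial_reducible _ _ _ (u%:R * N%:R ^+ 2)
          (N%:Z ^+ 2 - 63 * u%:Z ^+ 2)) => //.
(* The numerator 64u^2 - N^2 is odd, hence nonzero. *)
- have -> : A - 1 / (4 * u%:R) ^+ 2 =
            (64 * u%:Z ^+ 2 - N%:Z ^+ 2)%:~R / (N%:R * (4 * u%:R)) ^+ 2.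
    by rewrite rmorphB rmorphM 2!rmorphXn /= /A; field; rewrite N0 u0.
  rewrite mulf_neq0 ?invr_eq0 ?expf_neq0 ?mulf_neq0 // intr_eq0.
  have [[b bE]|[t ->]] := even_or_sqr_mod8 N; first by move: oddN; lia.
  by apply/eqP; move: (u%:Z ^+ 2) => U; clear; lia.
- exact: odd_square_diff.
- by rewrite rmorphB rmorphXn rmorphM rmorphXn /= /A /B; field; rewrite N0 u0.
Qed.

(** The loop invariant: the exponent stays a natural number at least 4, the range where both tests
    fail. *)
Lemma reduction_run_looping (R : realType) (eps : R) (n : nat) :
  admissible_eps (f_input R k oddN) eps ->
  (64 < N)%N ->
  exists2 l : nat, (4 <= l)%N &
    reduction_run (f_input R k oddN) eps n = Looping l.
Proof.
move=> [eps_gt0 eps_lt _] N64; elim: n => [|n [l l4 IH]]; last first.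
  exists l.+1; first exact: ltnW.
  rewrite /reduction_run iterS -/(reduction_run _ _ _) IH /reduction_step /=.
  case: asboolP => [/(step_a_reducible l4)//|_].
  case: asboolP => [/(step_b_reducible l4)//|_].
  by rewrite -addn1.
have f0 : real_eval (f_poly k N) (0 : R) = 4 / N%:R ^+ 2.
  rewrite /real_eval /f_poly !rmorphD !rmorphM /= !map_polyC /= !map_polyXn.
  rewrite !(hornerD, hornerM, hornerC, hornerXn) mulnC exprM addn1 expr0n /=.
  by rewrite !(rmorphM, fmorphV, rmorphXn, rmorph_nat) /=; ring.
(* The infimum is at most f(0) = 4/N^2, and N >= 64 bounds this by 4/64^2 = 2^-10. Positivity of f
   supplies the lower bound that [ge_inf] requires. *)
have eps_lt10 : eps < (2 ^+ 10)^-1.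
  apply: (lt_le_trans eps_lt); apply: (@le_trans _ _ (4 / N%:R ^+ 2)).
    rewrite -f0; apply: ge_inf; last by exists 0.
    by exists 0 => _ [t _ <-]; exact/ltW/f_poly_positive.
  have N64R : 64 <= N%:R :> R by rewrite ler_nat ltnW.
  rewrite ler_pdivrMr ?exprn_gt0 ?ltr0n ?odd_gt0 //.
  rewrite ler_pdivlMl ?exprn_gt0 //; nra.
have ln2 : 0 < ln 2 :> R by rewrite ln_gt0 // ltr1n.
have ceil5 : 4%:Z < Num.ceil (- (1 / 2) * log2 eps).
  rewrite ceil_gt_int /log2.
  have : ln eps / ln 2 < - 10.
    rewrite ltr_pdivrMr // mulNr mulrC mulr_natr -lnXn // -lnV ?posrE ?exprn_gt0 //.
    by rewrite ltr_ln ?posrE ?invr_gt0 ?exprn_gt0.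
  move: (ln eps / ln 2) => q q10.
  change (4 < - (1 / 2) * q); lra.
rewrite /reduction_run /= /reduction_start.
case: asboolP => [/f_poly_not_sum_of_4_squares//|_].
(* The initial exponent is an integer; the bound excludes the negative constructor. *)
case: (Num.ceil _) ceil5 => // l l5; exists l => //.
exact: ltnW.
Qed.

End FPoly.

Local Close Scope ring_scope.

Theorem theorem1p1 (R : realType) (k N : nat) (oddN : odd N) (N_gt64 : 64 < N)
    (eps : R) (eps_adm : admissible_eps (f_input R k oddN) eps)
    (n : nat) (h : {poly rat}) :
  reduction_run (f_input R k oddN) eps n <> Returned h.
Proof.
by have [l _ ->] := reduction_run_looping n eps_adm N_gt64.
Qed.
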